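(* Let $(X,d)$ be a compact metric space, $\boldsymbol f=\{f_i\}_{i=1}^\infty$ an equicontinuous sequence of self-maps of $X$, and $\varphi\equiv c$ a constant function. Then, for any $Z\subseteq X$, any $\theta\in[0,1]$ and all $m\in\mathbb N$, $$\underline P(\boldsymbol f^m,Z,S_m\varphi,\theta)=m\,\underline P(\boldsymbol f,Z,\varphi,\theta),\qquad \overline P(\boldsymbol f^m,Z,S_m\varphi,\theta)=m\,\overline P(\boldsymbol f,Z,\varphi,\theta),$$ where $\underline P,\overline P$ denote the lower and upper $\theta$-intermediate topological pressures.
   Context: Pressures take values in $[-\infty,+\infty]$. For a sequence $\boldsymbol f=\{f_i\}_{i\ge1}$ of continuous self-maps put $f_i^0=\mathrm{id}_X$, $f_i^n=f_{i+n-1}\circ\cdots\circ f_i$, and $S_n\varphi(x)=S_n^{\boldsymbol f}\varphi(x)=\sum_{j=0}^{n-1}\varphi(f_1^j x)$. $\boldsymbol f^m$ denotes the sequence of maps $\{f_{im+1}^m\}_{i=0}^\infty$; in $\underline P(\boldsymbol f^m,Z,S_m\varphi,\theta)$ the potential is $S_m\varphi=S_m^{\boldsymbol f}\varphi$ and the pressure is that of the system $\boldsymbol f^m$. $\mathbb N$ is the set of positive integers. For a finite open cover $\mathcal U$ of $X$, $\mathcal S_m(\mathcal U)$ is the set of strings $\mathbf U=(U_0,\dots,U_{m-1})$ with all $U_j\in\mathcal U$; $m(\mathbf U)=m$ is the length of $\mathbf U$; and $X_{\boldsymbol f}(\mathbf U)=\{x\in X: f_1^j(x)\in U_j,\ 0\le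 j\le m-1\}$. For $Z\subseteq X$, $\alpha\in\mathbb R$, $N\in\mathbb N$, $\theta\in[0,1]$ and continuous $\varphi:X\to\mathbb R$ let $$M(Z,\alpha,\varphi,\mathcal U,N,\theta)=\inf_{\mathcal G}\sum_{\mathbf U\in\mathcal G}\exp\Bigl(-\alpha m(\mathbf U)+\sup_{x\in X_{\boldsymbol f}(\mathbf U)}S^{\boldsymbol f}_{m(\mathbf U)}\varphi(x)\Bigr),$$ the infimum over all finite or countable collections $\mathcal G$ of strings of lengths $m$ with $N\le m<N/\theta+1$ (for $\theta=0$: $m\ge N$) such that $Z\subseteq\bigcup_{\mathbf U\in\mathcal G}X_{\boldsymbol f}(\mathbf U)$; the supremum over an empty set is $-\infty$ (so the term is $0$). Let $\underline m$ and $\overline m$ be the $\liminf$ and $\limsup$ of $M(Z,\alpha,\varphi,\mathcal U,N,\theta)$ as $N\to\infty$, and $$\underline P(\boldsymbol f,Z,\varphi,\mathcal U,\theta)=\inf\{\alpha:\underline m=0\}=\sup\{\alpha:\underline m=\infty\},\quad \overline P(\boldsymbol f,Z,\varphi,\mathcal U,\theta)=\inf\{\alpha:\overline m=0\}=\sup\{\alpha:\overline m=\infty\}.$$ With $|\mathcal U|=\max_{U\in\mathcal U}\operatorname{diam}U$, the lower and upper $\theta$-intermediate topological pressures are $\underline P(\boldsymbol f,Z,\varphi,\theta)=\lim_{|\mathcal U|\to0}\underline P(\boldsymbol f,Z,\varphi,\mathcal U,\theta)$ and $\overline P(\boldsymbol f,Z,\varphi,\theta)=\lim_{|\mathcal U|\to0}\overline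 P(\boldsymbol f,Z,\varphi,\mathcal U,\theta)$ (these limits exist). *)

(* Defs.v *)
From HB Require Import structures.
From mathcomp Require Import all_boot all_order all_algebra.
From mathcomp Require Import all_classical all_reals all_analysis.

Set Implicit Arguments.
Unset Strict Implicit.
Unset Printing Implicit Defensive.

Import Order.TTheory GRing.Theory Num.Theory.
Import numFieldNormedType.Exports.

Local Open Scope classical_set_scope.
Local Open Scope ring_scope.

(* Sequences of maps are indexed from 0: [f i] stands for f_{i+1}. *)

(* The library's [equicontinuous] requires a pointed codomain, which would
   exclude the empty space, and is the pointwise version. *)
Definition equicontinuous_seq (R : realType) (X : metricType R)
    (f : nat -> X -> X) : Prop :=
  forall e : R, 0 < e -> exists2 d : R, 0 < d &
    forall i x y, mdist x y < d -> mdist (f i x) (f i y) < e.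

(* [seq_iter f i n] is f_{i+1}^n = f_{i+n} o ... o f_{i+1}. *)
Fixpoint seq_iter (X : Type) (f : nat -> X -> X) (i n : nat) : X -> X :=
  if n is n'.+1 then f (i + n')%N \o seq_iter f i n' else id.

(* The sequence f^m, whose term of index i is f_{im+1}^m. *)
Definition seq_pow (X : Type) (f : nat -> X -> X) (m : nat) : nat -> X -> X :=
  fun i => seq_iter f (i * m) m.

Definition birkhoff_sum (R : realType) (X : Type) (f : nat -> X -> X)
    (n : nat) (phi : X -> R) : X -> R :=
  fun x => \sum_(0 <= j < n) phi (seq_iter f 0 j x).

Definition finite_open_cover (X : topologicalType) (C : set (set X)) : Prop :=
  [/\ finite_set C, (forall U, C U -> open U) & \bigcup_(U in C) U = [set: X]].

(* The point 0 is adjoined so that the empty set has diameter 0. *)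
Definition diam (R : realType) (X : metricType R) (U : set X) : \bar R :=
  ereal_sup (0%E |` [set (mdist p.1 p.2)%:E | p in U `*` U]).

Definition mesh (R : realType) (X : metricType R) (C : set (set X)) : \bar R :=
  ereal_sup (0%E |` [set diam U | U in C]).

(* The filter |C| -> 0 on finite open covers. *)
Definition mesh_to0 (R : realType) (X : metricType R) :
    set_system (set (set X)) :=
  filter_from [set e : R | 0 < e]
    (fun e => [set C | finite_open_cover C /\ (mesh C < e%:E)%E]).

Arguments mesh_to0 {R} X.

Definition strings (X : Type) (C : set (set X)) (n : nat) : set (seq (set X)) :=
  [set U | size U = n /\ forall A, A \in U -> C A].

Definition string_set (X : Type) (f : nat -> X -> X) (U : seq (set X)) :
    set X :=
  [set x | forall j, (j < size U)%N -> nth set0 U j (seq_iter f 0 j x)].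

(* N <= n < N / theta + 1, the upper bound being +oo when theta = 0; the case
   is separated because N / 0 = 0 in a field. *)
Definition admissible_length (R : realType) (theta : R) (N n : nat) : Prop :=
  (N <= n)%N /\ (theta != 0 -> n%:R < N%:R / theta + 1).

Definition admissible_family (R : realType) (X : Type) (f : nat -> X -> X)
    (Z : set X) (C : set (set X)) (N : nat) (theta : R)
    (G : set (seq (set X))) : Prop :=
  [/\ countable G,
      G `<=` \bigcup_(n in admissible_length theta N) strings C n &
      Z `<=` \bigcup_(U in G) string_set f U].

(* If [string_set f U] is empty the supremum is -oo and expeR -oo = 0. *)
Definition string_weight (R : realType) (X : Type) (f : nat -> X -> X)
    (alpha : R) (phi : X -> R) (U : seq (set X)) : \bar R :=
  expeR ((- alpha * (size U)%:R)%:E +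
    ereal_sup [set (birkhoff_sum f (size U) phi x)%:E | x in string_set f U])%E.

Definition cover_measure (R : realType) (X : Type) (f : nat -> X -> X)
    (Z : set X) (alpha : R) (phi : X -> R) (C : set (set X)) (N : nat)
    (theta : R) : \bar R :=
  ereal_inf [set (\esum_(U in G) string_weight f alpha phi U)%E
            | G in admissible_family f Z C N theta].

Definition lower_pressure_cover (R : realType) (X : Type) (f : nat -> X -> X)
    (Z : set X) (phi : X -> R) (C : set (set X)) (theta : R) : \bar R :=
  ereal_inf [set alpha%:E | alpha in [set alpha : R |
    limn_einf (fun N => cover_measure f Z alpha phi C N theta) = 0%E]].

Definition upper_pressure_cover (R : realType) (X : Type) (f : nat -> X -> X)
    (Z : set X) (phi : X -> R) (C : set (set X)) (theta : R) : \bar R :=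
  ereal_inf [set alpha%:E | alpha in [set alpha : R |
    limn_esup (fun N => cover_measure f Z alpha phi C N theta) = 0%E]].

Definition lower_pressure (R : realType) (X : metricType R) (f : nat -> X -> X)
    (Z : set X) (phi : X -> R) (theta : R) : \bar R :=
  lim (lower_pressure_cover f Z phi C theta @[C --> mesh_to0 X]).

Definition upper_pressure (R : realType) (X : metricType R) (f : nat -> X -> X)
    (Z : set X) (phi : X -> R) (theta : R) : \bar R :=
  lim (upper_pressure_cover f Z phi C theta @[C --> mesh_to0 X]).

(* Main.v *)
(* Since the potential is constant, the weight of a string with non-empty
   string set depends only on its length. Sampling a string of [f] at the times
   0, m, 2m, ... gives a string of [f^m] of length ceil(n / m) on the same
   cover; conversely, when the elements of a cover D are so small that their
   images under at most 2m iterates of [f] are subordinate to C, a string of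
   length k of [f^m] on D yields one of [f] on C of any length n <= (k + 1) m.
   With lengths chosen to stay admissible, both operations change weights by a
   bounded factor only, so that
     P(f^m, C) <= m P(f, C) <= P(f^m, D) for D fine enough.
   These two inequalities also show that both pressures converge, as the mesh
   tends to 0, to their suprema over all finite open covers. *)

Require Import Defs.
From HB Require Import structures.
From mathcomp Require Import all_boot all_order all_algebra.
From mathcomp Require Import all_classical all_reals all_analysis.
From mathcomp Require Import zify lra.

Set Implicit Arguments.
Unset Strict Implicit.
Unset Printing Implicit Defensive.

Import Order.TTheory GRing.Theory Num.Theory.
Import numFieldNormedType.Exports.

Local Open Scope classical_set_scope.
Local Open Scope ring_scope.

(** * Sums, limits and infima in the extended reals *)

Lemma esum_image_le (R : realType) (T U : choiceType) (h : T -> U) (G : set T)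
    (v : T -> \bar R) (w : U -> \bar R) (K : R) :
  0 <= K -> (forall x, 0 <= v x)%E ->
  (forall x, G x -> w (h x) <= K%:E * v x)%E ->
  (\esum_(y in h @` G) w y <= K%:E * \esum_(x in G) v x)%E.
Proof.
move=> K0 v0 wv; have [->|/set0P[x0 Gx0]] := eqVneq G set0.
  by rewrite image_set0 !esum_set0 mule0.
(* One preimage [t y] is kept for each point of the image: [t] is injective there, so sums over the
   image become sums over subsets of [G] although [h] may merge points. *)
have /choice[t tP] : forall y, exists x, (h @` G) y -> G x /\ h x = y.
  move=> y; have [[x Gx hx]|] := pselect ((h @` G) y); first by exists x.
  by exists x0.
have tinj : set_inj (h @` G) t.
  by move=> y z /set_mem/tP[_ {2}<-] /set_mem/tP[_ {2}<-] ->.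
apply: (@le_trans _ _ (\esum_(y in h @` G) (K%:E * v (t y)))%E).
  by apply: le_esum => y /tP[Gt {1}<-]; exact: wv.
apply: ge_ereal_sup => _ [A [finA AG] <-].
rewrite -ge0_mule_fsumr// lee_wpmul2l//.
apply: esum_ge; exists (t @` A); first split.
- exact: finite_image.
- by move=> _ [y Ay <-]; have [] := tP _ (AG _ Ay).
- rewrite fsbig_image//.
  by move=> y z yA zA; apply: tinj; apply/mem_set/AG/set_mem.
Qed.

Lemma limn_esup0P (R : realType) (u : (\bar R)^nat) : (forall n, 0 <= u n)%E ->
  limn_esup u = 0%E <-> u @ \oo --> 0%E.
Proof.
move=> u0; split=> [u0E|/cvg_limn_einf_sup[]//].
by apply: limn_esup_le_cvg => //; rewrite u0E.
Qed.

(** The lower limit is the supremum of the tail infima, all non-negative here, so it vanishes iff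
    each of them does. *)
Lemma limn_einf0P (R : realType) (u : (\bar R)^nat) : (forall n, 0 <= u n)%E ->
  limn_einf u = 0%E <->
  forall (e : R) n, 0 < e -> exists2 k, (n <= k)%N & (u k < e%:E)%E.
Proof.
move=> u0; rewrite limn_einf_lim.
rewrite (cvg_lim (@ereal_hausdorff R) (@cvg_einfs_sup _ u)).
split=> [uE e n e0|ulte].
  have : (einfs u n < e%:E)%E.
    rewrite (@le_lt_trans _ _ 0%E) ?lte_fin//.
    by rewrite -uE; apply: ereal_sup_ubound; exists n.
  by move=> /ereal_inf_lt[_ [k /= nk <-] uke]; exists k.
apply/eqP; rewrite eq_le; apply/andP; split; last first.
  apply: ereal_sup_ge; exists (einfs u 0); first by exists 0%N.
  by apply: le_ereal_inf_tmp => _ [k _ <-].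
apply: ge_ereal_sup => _ [n _ <-]; apply/lee_addgt0Pr => e e0.
have [k nk uke] := ulte e n e0; rewrite add0e (le_trans _ (ltW uke))//.
by apply: ereal_inf_lbound; exists k.
Qed.

Section comparison.
Context (R : realType) (u v : (\bar R)^nat) (K : R) (s : nat -> nat).
Hypotheses (u0 : forall n, (0 <= u n)%E) (v0 : forall n, (0 <= v n)%E).
Hypotheses (K0 : 0 < K) (soo : s @ \oo --> \oo).

Lemma limn_esup0_le : (\forall n \near \oo, (u n <= K%:E * v (s n))%E) ->
  limn_esup v = 0%E -> limn_esup u = 0%E.
Proof.
move=> uv /(limn_esup0P v0) v_0; apply/(limn_esup0P u0).
apply: (@squeeze_cvge _ _ _ _ (cst 0%E) _ (fun n => K%:E * v (s n))%E).
- by near=> n; rewrite u0/=; near: n.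
- exact: cvg_cst.
rewrite -[X in _ --> X](mule0 K%:E); apply: cvgeZl => //.
exact: (cvg_comp _ _ soo v_0).
Unshelve. all: by end_near. Qed.

(** For a lower limit it is enough to find small values of [u] arbitrarily far out, so [s] reindexes
    [u] here; the upper limit needs every late [u n], and there [s] reindexes [v]. *)
Lemma limn_einf0_le : (\forall n \near \oo, (u (s n) <= K%:E * v n)%E) ->
  limn_einf v = 0%E -> limn_einf u = 0%E.
Proof.
move=> [N _ uv] /(limn_einf0P v0) v_0; apply/(limn_einf0P u0) => e n e0.
have [M _ sM] := @soo _ (nbhs_infty_ge n).
have [|k] := v_0 (K^-1 * e) (maxn N M); first by rewrite mulr_gt0 ?invr_gt0.
rewrite geq_max => /andP[Nk Mk] vk; exists (s k); first exact: sM.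
by rewrite (le_lt_trans (uv _ Nk))// -lte_pdivlMl.
Qed.

End comparison.

Lemma cvge_lub (R : realType) (T : Type) (F : set_system T) (FF : Filter F)
    (f : T -> \bar R) (l : \bar R) :
  (\forall x \near F, (f x <= l)%E) ->
  (forall a : R, (a%:E < l)%E -> \forall x \near F, (a%:E <= f x)%E) ->
  f @ F --> l.
Proof.
case: l => [r| |] fl lf.
- move=> P /nbhs_EFin/nbhs_ballP[e /= e0 eP].
  have := lf (r - e / 2).
  rewrite lte_fin ltrBlDr ltrDl divr_gt0// => /(_ isT) fr.
  change (\forall x \near F, P (f x)); near=> x.
  have : (f x <= r%:E)%E by near: x.
  have : ((r - e / 2)%:E <= f x)%E by near: x.
  case: (f x) => [s| |]//; rewrite !lee_fin => rs sr.
  by apply: eP; rewrite /ball/= ger0_norm ?subr_ge0//; lra.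
- by apply/cvgeyPge => a; apply: lf; rewrite ltry.
- apply/cvgeNyPle => a; near=> x; rewrite (@le_trans _ _ -oo%E) ?leNye//.
  by near: x.
Unshelve. all: by end_near. Qed.

(** [S] and [T] stand for the exponents at which the limits for [f] and for its power vanish; [b]
    for [f] corresponds to [m * b] for the power. *)
Lemma ereal_inf_pZ_le (R : realType) (S T : set R) (m : R) : 0 < m ->
  (forall b, S b -> T (m * b)) ->
  (ereal_inf [set a%:E | a in T] <= m%:E * ereal_inf [set b%:E | b in S])%E.
Proof.
move=> m0 ST; rewrite -lee_pdivrMl//; apply: le_ereal_inf_tmp => _ [b Sb <-].
rewrite lee_pdivrMl//; apply: ereal_inf_lbound; exists (m * b) => //.
exact: ST.
Qed.

Lemma ereal_inf_pZ_ge (R : realType) (S T : set R) (m : R) : 0 < m ->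
  (forall b, T (m * b) -> S b) ->
  (m%:E * ereal_inf [set b%:E | b in S] <= ereal_inf [set a%:E | a in T])%E.
Proof.
move=> m0 TS; apply: le_ereal_inf_tmp => _ [a Ta <-].
rewrite -lee_pdivlMl//; apply: ereal_inf_lbound; exists (m^-1 * a) => //.
by apply: TS; rewrite mulVKf// gt_eqF.
Qed.

(** * Iterates and strings *)

Section iterates.
Context (X : Type) (f : nat -> X -> X).

Lemma seq_iterD i n k :
  seq_iter f i (n + k) = seq_iter f (i + n) k \o seq_iter f i n.
Proof.
elim: k => [|k IH]; first by rewrite addn0.
by rewrite addnS /= IH addnA.
Qed.

Lemma seq_iter_pow m j : seq_iter (seq_pow f m) 0 j = seq_iter f 0 (j * m).
Proof.
elim: j => [//|j IH] /=.
by rewrite IH !add0n mulSn addnC seq_iterD /seq_pow add0n.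
Qed.

Lemma string_cover (C : set (set X)) n (S : set X) :
  (forall i, (i < n)%N -> exists2 A, C A & S `<=` seq_iter f 0 i @^-1` A) ->
  exists2 U, strings C n U & S `<=` string_set f U.
Proof.
move=> SC; have /choice[A AP] : forall i, exists A, (i < n)%N ->
    C A /\ S `<=` seq_iter f 0 i @^-1` A.
  move=> i; have [ltin|_] := boolP (i < n)%N; last by exists set0.
  by have [A CA SA] := SC i ltin; exists A.
exists (mkseq A n); first split.
- by rewrite size_mkseq.
- by move=> _ /mapP[i + ->]; rewrite mem_iota => /= /AP[].
- move=> x Sx j; rewrite size_mkseq => jn; rewrite nth_mkseq//.
  by have [_ /(_ _ Sx)] := AP _ jn.
Qed.

Lemma string_weight_const (R : realType) (phi : X -> R) c alpha U :
  (forall x, phi x = c) -> string_set f U !=set0 ->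
  string_weight f alpha phi U = (expR ((c - alpha) * (size U)%:R))%:E.
Proof.
move=> phic [x0 Ux0]; rewrite /string_weight.
have S x : birkhoff_sum f (size U) phi x = c * (size U)%:R.
  rewrite /birkhoff_sum; under eq_bigr do rewrite phic.
  by rewrite sumr_const_nat subn0 mulr_natr.
under eq_imagel do rewrite S.
rewrite set_cst; case: eqP => [E|_].
  by move: Ux0; rewrite E.
by rewrite ereal_sup1 -EFinD/= mulrBl mulNr addrC.
Qed.

End iterates.

(** * Finite open covers of a compact metric space and the limit of vanishing mesh *)

Section covers.
Context (R : realType) (X : metricType R).
Hypothesis hX : compact [set: X].

Lemma mdist_le_mesh (C : set (set X)) (V : set X) (e : R) :
  (mesh C < e%:E)%E -> C V -> forall x y, V x -> V y -> mdist x y < e.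
Proof.
move=> Ce CV x y Vx Vy; rewrite -lte_fin; apply: le_lt_trans Ce.
apply: (@le_trans _ _ (diam V)); apply: ereal_sup_ubound; right.
  by exists (x, y).
by exists V.
Qed.

(** Near-covering compactness turns a radius valid near each point into a common one; halving [e]
    leaves room for the triangle inequality. *)
Lemma lebesgue_number (C : set (set X)) : finite_open_cover C ->
  exists2 d : R, 0 < d & forall x, exists2 A, C A & ball x d `<=` A.
Proof.
move=> [_ Copen Ccover].
have /compact_near_coveringP/(_ R 0^'+
  (fun d x => exists2 A, C A & ball x d `<=` A) _) := hX.
case=> [x _|d /= d0 dP].
  have [A CA Ax] : (\bigcup_(U in C) U) x by rewrite Ccover.
  have /nbhs_ballP[e /= e0 eA] : nbhs x A.
    by apply: open_nbhs_nbhs; split=> //; exact: Copen.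
  exists (ball x (e / 2), [set d | d < e / 2]) => /=.
    by split; [apply: nbhsx_ballx|apply: nbhs_right_lt]; rewrite divr_gt0.
  move=> [y d]/= [xy de]; exists A => //; apply: subset_trans eA => z yz.
  rewrite (splitr e); apply: ball_triangle xy _.
  by apply: le_ball yz; exact: ltW.
exists (d / 2); first by rewrite divr_gt0.
move=> x; apply: (dP (d / 2)) => //=; last by rewrite divr_gt0.
by rewrite sub0r normrN gtr0_norm ?divr_gt0// ltr_pdivrMr// ltr_pMr// ltr1n.
Qed.

(** Total boundedness, from near-covering compactness along the filter of finite sets directed by
    inclusion: around [x], every finite set containing [x] works. *)
Lemma finite_ball_cover (e : R) : 0 < e ->
  exists2 D : set X, finite_set D & forall x, exists2 c, D c & ball c e x.
Proof.
move=> e0; pose F := filter_from (@finite_set X)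
  (fun A => [set D | finite_set D /\ A `<=` D]).
have FF : Filter F.
  apply: filter_from_filter; first by exists set0.
  move=> A B finA finB; exists (A `|` B); first by rewrite finite_setU.
  by move=> D [finD]; rewrite subUset => -[].
have /compact_near_coveringP/(_ (set X) F
  (fun D x => exists2 c, D c & ball c e x) FF) := hX.
case=> [x _|A finA AP].
  exists (ball x e, [set D | finite_set D /\ [set x] `<=` D]) => /=.
    by split; [exact: nbhsx_ballx|exists [set x]].
  by move=> [y D]/= [xy [_ xD]]; exists x => //; exact: xD.
by exists A => // x; apply: (AP A _ x I); split.
Qed.

Lemma exists_fine_cover (e : R) : 0 < e ->
  exists2 C : set (set X), finite_open_cover C & (mesh C < e%:E)%E.
Proof.
move=> e0; have e40 : 0 < e / 4 by rewrite divr_gt0.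
have [D finD DP] := finite_ball_cover e40.
(* Radius [e / 4] keeps diameters at most [e / 2], so the mesh is strictly below [e]; interiors
   provide openness. *)
exists [set (ball c (e / 4))° | c in D].
  split; first exact: finite_image.
    by move=> _ [c _ <-]; exact: open_interior.
  apply/seteqP; split=> // x _; have [c Dc cx] := DP x.
  exists (ball c (e / 4))°; first by exists c.
  rewrite /interior /= -nbhs_ballE.
  have : mdist c x < e / 4 by move: cx; rewrite ballEmdist.
  rewrite -subr_gt0 => r0; exists (e / 4 - mdist c x) => //= y.
  rewrite !ballEmdist /= => xy; apply: le_lt_trans (metric_triangle c x y) _.
  by rewrite addrC -ltrBrDr.
apply: (@le_lt_trans _ _ (e / 2)%:E); last by rewrite lte_fin; lra.
apply: ge_ereal_sup => _ [->|[_ [c _ <-] <-]]; first by rewrite lee_fin; lra.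
apply: ge_ereal_sup => _ [->|[[x y]/= [cx cy] <-]]; rewrite lee_fin; first lra.
move: cx cy => /interior_subset + /interior_subset.
rewrite !ballEmdist/= => cx cy.
by apply: le_trans (metric_triangle x c y) _; rewrite (metric_sym x c); lra.
Qed.

(** Properness amounts to the existence of arbitrarily fine covers; it makes limits along this
    filter unique. *)
#[local] Instance mesh_to0_filter : ProperFilter (@mesh_to0 R X).
Proof.
apply: filter_from_proper; last first.
  by move=> e e0; have [C hC Ce] := exists_fine_cover e0; exists C.
apply: filter_from_filter; first by exists 1 => /=.
move=> e1 e2 /= e10 e20; exists (Num.min e1 e2); first by rewrite /= lt_min e10.
move=> C [hC]; rewrite EFin_min lt_min => /andP[].
by split; split.
Qed.

Lemma cvg_mesh_to0 (F : set (set X) -> \bar R) :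
  (forall C, finite_open_cover C -> exists2 d : R, 0 < d &
    forall D, finite_open_cover D -> (mesh D < d%:E)%E -> (F C <= F D)%E) ->
  F C @[C --> mesh_to0 X] --> ereal_sup (F @` @finite_open_cover X).
Proof.
move=> FP; apply: cvge_lub.
  exists 1 => //= C [hC _]; apply: ereal_sup_ubound; exact: imageP.
move=> a /ereal_sup_gt[_ [C hC <-] aC].
have [d d0 dP] := FP C hC; exists d => //= D [hD Dd].
by rewrite (le_trans (ltW aC))// dP.
Qed.

(** For [D] fine, [m F(C) <= G(D) <= m F(D)] and [G(C) <= m F(C) <= G(D)]: each function is
    eventually above each of its values, hence tends to its supremum, and the suprema compare. *)
Lemma lim_mesh_to0_pZ (F G : set (set X) -> \bar R) (m : R) : 0 < m ->
  (forall C, finite_open_cover C -> (G C <= m%:E * F C)%E) ->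
  (forall C, finite_open_cover C -> exists2 d : R, 0 < d &
    forall D, finite_open_cover D -> (mesh D < d%:E)%E ->
      (m%:E * F C <= G D)%E) ->
  lim (G C @[C --> mesh_to0 X]) = (m%:E * lim (F C @[C --> mesh_to0 X]))%E.
Proof.
move=> m0 GF FG.
have cvgF : F C @[C --> mesh_to0 X] --> ereal_sup (F @` @finite_open_cover X).
  apply: cvg_mesh_to0 => C hC; have [d d0 dP] := FG C hC.
  exists d => // D hD Dd.
  rewrite -(lee_pmul2l (isT : m%:E \is a fin_num))//.
  by apply: le_trans (GF D hD); exact: dP.
have cvgG : G C @[C --> mesh_to0 X] --> ereal_sup (G @` @finite_open_cover X).
  apply: cvg_mesh_to0 => C hC; have [d d0 dP] := FG C hC.
  exists d => // D hD Dd.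
  by apply: le_trans (GF C hC) _; exact: dP.
rewrite (cvg_lim (@ereal_hausdorff R) cvgF) (cvg_lim (@ereal_hausdorff R) cvgG).
apply/eqP; rewrite eq_le; apply/andP; split.
  apply: ge_ereal_sup => _ [C hC <-]; apply: le_trans (GF C hC) _.
  by rewrite lee_pmul2l//; apply: ereal_sup_ubound; exists C.
rewrite -lee_pdivlMl//; apply: ge_ereal_sup => _ [C hC <-].
rewrite lee_pdivlMl//; have [d d0 dP] := FG C hC.
have [D hD Dd] := exists_fine_cover d0.
by apply: le_trans (dP D hD Dd) _; apply: ereal_sup_ubound; exists D.
Qed.

(** Induction on the number of maps; [d] does not depend on the starting index [i], so it serves
    every block of the power. *)
Lemma equicontinuous_iter (f : nat -> X -> X) (r : nat) (e : R) :
  equicontinuous_seq f -> 0 < e -> exists2 d : R, 0 < d &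
    forall i j x y, (j <= r)%N -> mdist x y < d ->
      mdist (seq_iter f i j x) (seq_iter f i j y) < e.
Proof.
move=> hf; elim: r e => [|r IH] e e0.
  by exists e => // i j x y; rewrite leqn0 => /eqP ->.
have [d d0 dP] := hf e e0; have [d1 d10 d1P] := IH _ d0.
have [d2 d20 d2P] := IH _ e0.
exists (Num.min d1 d2); first by rewrite lt_min d10.
move=> i j x y; rewrite leq_eqVlt lt_min => /orP[/eqP ->|jr] /andP[xy1 xy2].
  by apply: dP; exact: d1P.
exact: d2P.
Qed.

End covers.

(** * Comparison of cover measures *)

Lemma cover_measure_ge0 (R : realType) (X : Type) (f : nat -> X -> X)
    (Z : set X) (alpha : R) (phi : X -> R) C N theta :
  (0 <= cover_measure f Z alpha phi C N theta)%E.
Proof.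
apply: le_ereal_inf_tmp => _ [G _ <-].
by apply: esum_ge0 => U _; exact: expeR_ge0.
Qed.

(** Each string [V] of a family for [g] is traded for one string of [f] whose set contains that of
    [V], so [Z] stays covered and only the factor [K] is lost. With [f] and [g] arbitrary, this
    serves both directions. *)
Lemma cover_measure_le (R : realType) (X : Type) (f g : nat -> X -> X)
    (Z : set X) (a b c d : R) (phi psi : X -> R) (C D : set (set X))
    (N N' : nat) (theta K : R) :
  (forall x, phi x = c) -> (forall x, psi x = d) -> 0 < K ->
  (forall k, admissible_length theta N' k -> exists n,
    [/\ admissible_length theta N n,
        forall V i, strings D k V -> string_set g V !=set0 -> (i < n)%N ->
          exists2 A, C A & string_set g V `<=` seq_iter f 0 i @^-1` A &
        expR ((c - a) * n%:R) <= K * expR ((d - b) * k%:R)]) ->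
  (cover_measure f Z a phi C N theta <=
    K%:E * cover_measure g Z b psi D N' theta)%E.
Proof.
move=> phic psid K0 H; rewrite -lee_pdivrMl//.
apply: le_ereal_inf_tmp => _ [G [cG GD ZG] <-]; rewrite lee_pdivrMl//.
(* Strings with empty string set cover nothing; once they are discarded, the weight depends on the
   length alone. *)
pose G' := G `&` [set V | string_set g V !=set0].
have /choice[h hP] : forall V, exists U, G' V ->
    [/\ (\bigcup_(n in admissible_length theta N) strings C n) U,
        string_set g V `<=` string_set f U &
        expR ((c - a) * (size U)%:R) <= K * expR ((d - b) * (size V)%:R)].
  move=> V; have [[GV V0]|] := pselect (G' V); last by exists [::].
  have [k adk Vk] := GD _ GV; have [n [adn nP nK]] := H k adk.
  have [U Un VU] := string_cover (fun i => nP V i Vk V0).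
  exists U => _; split=> //; first by exists n.
  by have [-> _] := Un; have [-> _] := Vk.
apply: (@le_trans _ _ (\esum_(U in h @` G') string_weight f a phi U)%E).
  apply: ereal_inf_lbound; exists (h @` G') => //; split.
  - apply: sub_countable (card_image_le _ _) _; apply: sub_countable cG.
    by apply: subset_card_le; exact: subIsetl.
  - by move=> _ [V /hP[hV _ _] <-].
  - move=> x /ZG[V GV Vx]; have G'V : G' V by split=> //; exists x.
    by exists (h V); [exists V|have [_ + _] := hP V G'V; exact].
apply: (@le_trans _ _ (K%:E * \esum_(V in G') string_weight g b psi V)%E).
  apply: esum_image_le; first exact: ltW.
    by move=> V; exact: expeR_ge0.
  move=> V G'V; have [_ VU hK] := hP V G'V; have [_ V0] := G'V.
  rewrite (string_weight_const _ psid)// (string_weight_const _ phic).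
    by rewrite -EFinM lee_fin.
  by case: V0 => x Vx; exists x; exact: VU.
rewrite lee_pmul2l//; apply: ge_ereal_sup => _ [A [finA AG] <-].
apply: esum_ge; exists A => //; split=> //.
by apply: subset_trans AG _; exact: subIsetl.
Qed.

(** * Admissible lengths under division and multiplication by [m] *)

Section admissible.
Context (R : realType) (theta : R) (m : nat).
Hypotheses (htheta : 0 <= theta <= 1) (m0 : (0 < m)%N).

(** [(n + m.-1) %/ m] is the ceiling of [n / m], and [m] times it is at most
    [n + m - 1 < N / theta + m]; dividing by [m] gives the upper bound. *)
Lemma admissible_length_div N n : admissible_length theta N n ->
  admissible_length theta ((N + m.-1) %/ m) ((n + m.-1) %/ m).
Proof.
move=> [Nn tn]; split=> [|t0]; first by apply: leq_div2r; rewrite leq_add2r.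
have {}t0 : 0 < theta by rewrite lt_neqAle eq_sym t0; case/andP: htheta.
have {}tn := tn (lt0r_neq0 t0).
have mR : 0 < m%:R :> R by rewrite ltr0n.
rewrite -(ltr_pM2r mR) mulrDl mul1r mulrAC -natrM.
have kn : (((n + m.-1) %/ m * m)%:R <= n%:R + m%:R - 1 :> R).
  rewrite lerBrDr natr1 -natrD ler_nat.
  by have := leq_trunc_div (n + m.-1) m; lia.
have NN : N%:R / theta <= ((N + m.-1) %/ m)%:R * m%:R / theta.
  rewrite ler_pM2r ?invr_gt0// -natrM ler_nat.
  by have := divn_eq (N + m.-1) m; have := ltn_pmod (N + m.-1) m0; lia.
rewrite [X in _ < X + _]mulrAC; lra.
Qed.

(** Subtracting [m.-1] from [k * m] turns the slack [m] in the upper bound back into 1; the maximum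
    with [N] restores the lower bound, and [N < N / theta + 1] since [theta <= 1]. *)
Lemma admissible_length_mul N k : admissible_length theta (N %/ m) k ->
  admissible_length theta N (maxn (k * m - m.-1) N).
Proof.
move=> [Nk tk]; split=> [|t0]; first exact: leq_maxr.
have {}tk := tk t0; have {}t0 : 0 < theta.
  by rewrite lt_neqAle eq_sym t0; case/andP: htheta.
have Nt : N%:R <= N%:R / theta.
  by rewrite ler_pdivlMr// ler_piMr//; case/andP: htheta.
case: leqP => [_|Nkm]; first lra.
have mR : 0 < m%:R :> R by rewrite ltr0n.
move: tk; rewrite -(ltr_pM2r mR) mulrDl mul1r mulrAC -!natrM => tk.
have NN : (N %/ m * m)%:R / theta <= N%:R / theta.
  by rewrite ler_pM2r ?invr_gt0// ler_nat; exact: leq_trunc_div.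
have mE : m%:R = m.-1%:R + 1 :> R by rewrite natr1 prednK.
rewrite natrB; last by rewrite ltnW// -subn_gt0; lia.
lra.
Qed.

End admissible.

Lemma expR_near_le (R : realType) (t : R) (n k m : nat) :
  (n <= k + m)%N -> (k <= n + m)%N ->
  expR (t * n%:R) <= expR (m%:R * `|t|) * expR (t * k%:R).
Proof.
move=> nk kn; rewrite -expRD ler_expR -lerBlDr -mulrBr.
rewrite (le_trans (ler_norm _))// normrM mulrC ler_wpM2r//.
have : n%:R <= k%:R + m%:R :> R by rewrite -natrD ler_nat.
have : k%:R <= n%:R + m%:R :> R by rewrite -natrD ler_nat.
by move=> ? ?; rewrite ler_norml; lra.
Qed.

(** * Pressures of [f] and of its power *)

Section power.
Context (R : realType) (X : metricType R).
Hypothesis hX : compact [set: X].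
Context (f : nat -> X -> X) (phi : X -> R) (c : R) (Z : set X) (theta : R).
Context (m : nat).
Hypotheses (hphi : forall x, phi x = c) (htheta : 0 <= theta <= 1).
Hypothesis m0 : (0 < m)%N.

Lemma birkhoff_sum_cst x : birkhoff_sum f m phi x = m%:R * c.
Proof.
rewrite /birkhoff_sum; under eq_bigr do rewrite hphi.
by rewrite sumr_const_nat subn0 mulr_natl.
Qed.

Lemma cover_measure_pow_le (C : set (set X)) (b : R) (N : nat) :
  (cover_measure (seq_pow f m) Z (m%:R * b) (birkhoff_sum f m phi) C
     ((N + m.-1) %/ m) theta <=
   (expR (m%:R * `|c - b|))%:E * cover_measure f Z b phi C N theta)%E.
Proof.
apply: (cover_measure_le _ birkhoff_sum_cst hphi); first exact: expR_gt0.
move=> k /(admissible_length_div htheta m0) kN.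
exists ((k + m.-1) %/ m)%N; split=> //.
  (* For [i] below the ceiling of [k / m], the sampling time [i * m] is less than [k], so the
     sampled letter exists. *)
  move=> V i [kV VC] _ ik; have imk : (i * m < size V)%N.
    by rewrite kV; have := leq_trunc_div (k + m.-1) m; nia.
  exists (nth set0 V (i * m)); first by apply: VC; exact: mem_nth.
  by move=> x Vx; rewrite /preimage/= seq_iter_pow; exact: Vx.
rewrite -mulrBr mulrAC mulrC -natrM mulnC; apply: expR_near_le.
  by have := leq_trunc_div (k + m.-1) m; lia.
by have := divn_eq (k + m.-1) m; have := ltn_pmod (k + m.-1) m0; lia.
Qed.

(* Controlling iterates up to time [2m] rather than [m] lets a string of the
   power be prolonged past its last block, when its length is too short to be
   admissible, without increasing the number of strings. *)
Lemma cover_measure_le_pow (C : set (set X)) :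
  equicontinuous_seq f -> finite_open_cover C -> exists2 e : R, 0 < e &
    forall D, (mesh D < e%:E)%E -> forall b N, (m <= N)%N ->
  (cover_measure f Z b phi C N theta <=
   (expR (m%:R * `|c - b|))%:E *
   cover_measure (seq_pow f m) Z (m%:R * b) (birkhoff_sum f m phi) D
     (N %/ m) theta)%E.
Proof.
move=> hf hC; have [d d0 dP] := lebesgue_number hX hC.
have [e e0 eP] := equicontinuous_iter (2 * m) hf d0.
exists e => // D De b N mN.
apply: (cover_measure_le _ hphi birkhoff_sum_cst); first exact: expR_gt0.
move=> k kN; exists (maxn (k * m - m.-1) N)%N.
have Nkm : (N < k * m + m)%N.
  have [Nk _] := kN; apply: leq_trans (ltn_ceil N m0) _.
  by rewrite -mulSnr leq_mul2r ltnS Nk orbT.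
(* [m <= N] makes [k] positive, so that a last letter, of index [k.-1], exists. *)
have k0 : (0 < k)%N.
  by have [+ _] := kN; apply: leq_trans; rewrite divn_gt0.
split; first exact: admissible_length_mul.
- move=> V i [kV VD] [x Vx] ikm.
  pose j := minn (i %/ m)%N k.-1; pose r := (i - j * m)%N.
  have jk : (j < size V)%N by rewrite kV /j; lia.
  have jmi : (j * m <= i)%N.
    by apply: leq_trans (leq_trunc_div i m); rewrite leq_mul2r geq_minl orbT.
  have r2m : (r <= 2 * m)%N.
    have ikm' : (i < k * m + m)%N by move: ikm; rewrite leq_max; lia.
    rewrite /r leq_subLR /j; case: leqP => ?.
      by have := ltn_ceil i m0; nia.
    by nia.
  have iE y : seq_iter f 0 i y =
      seq_iter f (j * m) r (seq_iter (seq_pow f m) 0 j y).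
    by rewrite seq_iter_pow -[in LHS](subnKC jmi) seq_iterD add0n.
  (* At time [i], all orbits starting in the string set are within [d] of that of [x], so the letter
     chosen around the latter contains them. *)
  have [A CA dA] := dP (seq_iter f 0 i x); exists A => // y Vy.
  apply: dA; rewrite ballEmdist /= !iE; apply: eP => //.
  apply: (mdist_le_mesh De (V := nth set0 V j)).
  + by apply: VD; exact: mem_nth.
  + exact: Vx.
  + exact: Vy.
- rewrite -mulrBr [m%:R * (c - b)]mulrC -[in X in _ <= X]mulrA -natrM mulnC.
  by apply: expR_near_le; lia.
Qed.

Lemma div_oo : (fun N => N %/ m)%N @ \oo --> \oo.
Proof.
move=> A [N _ NA]; exists (N * m)%N => // n /= Nn.
by apply: NA => /=; rewrite leq_divRL.
Qed.

Lemma ceil_oo : (fun N => (N + m.-1) %/ m)%N @ \oo --> \oo.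
Proof.
move=> A [N _ NA]; exists (N * m)%N => // n /= Nn.
by apply: NA => /=; rewrite leq_divRL// (leq_trans Nn)// leq_addr.
Qed.

Lemma mul_oo : (fun N => N * m)%N @ \oo --> \oo.
Proof.
move=> A [N _ NA]; exists N => // n /= Nn.
by apply: NA => /=; rewrite (leq_trans Nn)// leq_pmulr.
Qed.

Let mR0 : 0 < m%:R :> R. Proof. by rewrite ltr0n. Qed.

Lemma pressure_cover_pow_le (C : set (set X)) :
  (lower_pressure_cover (seq_pow f m) Z (birkhoff_sum f m phi) C theta <=
     m%:R%:E * lower_pressure_cover f Z phi C theta)%E /\
  (upper_pressure_cover (seq_pow f m) Z (birkhoff_sum f m phi) C theta <=
     m%:R%:E * upper_pressure_cover f Z phi C theta)%E.
Proof.
split; apply: (ereal_inf_pZ_le mR0) => b /=.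
  apply: (limn_einf0_le _ _ (expR_gt0 (m%:R * `|c - b|)) ceil_oo).
  - by move=> n; exact: cover_measure_ge0.
  - by move=> n; exact: cover_measure_ge0.
  - by apply: nearW => n; exact: cover_measure_pow_le.
(* Every index [n] of the power is reached exactly: the ceiling of [n * m / m] is [n]. *)
apply: (limn_esup0_le (K := expR (m%:R * `|c - b|)) _ _ mul_oo).
- by move=> n; exact: cover_measure_ge0.
- by move=> n; exact: cover_measure_ge0.
- apply: nearW => n; have := cover_measure_pow_le C b (n * m).
  by rewrite divnMDl// divn_small ?addn0// prednK.
Qed.

Lemma pressure_cover_le_pow (C : set (set X)) :
  equicontinuous_seq f -> finite_open_cover C -> exists2 e : R, 0 < e &
    forall D, (mesh D < e%:E)%E ->
  (m%:R%:E * lower_pressure_cover f Z phi C theta <=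
     lower_pressure_cover (seq_pow f m) Z (birkhoff_sum f m phi) D theta)%E /\
  (m%:R%:E * upper_pressure_cover f Z phi C theta <=
     upper_pressure_cover (seq_pow f m) Z (birkhoff_sum f m phi) D theta)%E.
Proof.
move=> hf hC; have [e e0 eP] := cover_measure_le_pow hf hC.
exists e => // D De; split; apply: (ereal_inf_pZ_ge mR0) => b /=.
  apply: (limn_einf0_le _ _ (expR_gt0 (m%:R * `|c - b|)) mul_oo).
  - by move=> n; exact: cover_measure_ge0.
  - by move=> n; exact: cover_measure_ge0.
  (* [n = 0] is excluded because the comparison requires [m <= n * m]. *)
  - exists 1%N => // n /= n0; have := eP D De b (n * m)%N.
    by rewrite mulnK//; apply; rewrite leq_pmull.
apply: (limn_esup0_le (K := expR (m%:R * `|c - b|)) _ _ div_oo).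
- by move=> n; exact: cover_measure_ge0.
- by move=> n; exact: cover_measure_ge0.
- by exists m => // n /= mn; exact: eP.
Qed.

End power.

Theorem proposition3p2 (R : realType) (X : metricType R)
    (hX : compact [set: X])
    (f : nat -> X -> X) (hf : equicontinuous_seq f)
    (phi : X -> R) (c : R) (hphi : forall x, phi x = c)
    (Z : set X) (theta : R) (htheta : 0 <= theta <= 1)
    (m : nat) (hm : (0 < m)%N) :
  lower_pressure (seq_pow f m) Z (birkhoff_sum f m phi) theta
    = (m%:R%:E * lower_pressure f Z phi theta)%E /\
  upper_pressure (seq_pow f m) Z (birkhoff_sum f m phi) theta
    = (m%:R%:E * upper_pressure f Z phi theta)%E.
Proof.
have m0 : 0 < m%:R :> R by rewrite ltr0n.
split; apply: lim_mesh_to0_pZ => // C hC.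
- by have [] := pressure_cover_pow_le f Z hphi htheta hm C.
- have [e e0 eP] := pressure_cover_le_pow hX Z hphi htheta hm hf hC.
  by exists e => // D _ /eP[].
- by have [] := pressure_cover_pow_le f Z hphi htheta hm C.
- have [e e0 eP] := pressure_cover_le_pow hX Z hphi htheta hm hf hC.
  by exists e => // D _ /eP[].
Qed.
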